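(* In the Ising mixed $p$-spin model with parameters $(\xi,h)$, let $Q_N$ be, for each $N$, a (random) nearest-neighbor Markov transition matrix on $\Sigma_N$ satisfying detailed balance with respect to the Gibbs measure $\pi_N$, and let $\lambda_1$ be the spectral gap of $I-Q_N$. If, almost surely for all $N$, $Q_N$ is $P_{SRW}$-coercive with constant $A_N$, then there is some constant $c'>0$ such that $$\limsup_{N\to\infty}\frac1N\log\mathbb P\Big(\frac1N\log\lambda_1<-c'+\frac1N\log A_N\Big)<0 .$$
   Context: **Model.** For $N\ge1$ let $\Sigma_N=\{-1,1\}^N$ and let $d\sigma$ be the uniform probability measure on $\Sigma_N$. Let $\xi(t)=\sum_{p\ge1}\beta_p^2t^p$ with $\xi(1+\epsilon)<\infty$ for some $\epsilon>0$, and $h\ge0$. $H_N$ is the Gaussian process on $\Sigma_N$ with $\mathbb{E}H_N(\sigma)=h\sum_i\sigma_i$ and $\mathrm{Cov}(H_N(\sigma^1),H_N(\sigma^2))=N\xi\big(\frac1N\sum_i\sigma^1_i\sigma^2_i\big)$. The Gibbs measure is $\pi_N(d\sigma)=e^{-H_N(\sigma)}d\sigma/Z_N$. **Dynamics.** $Q_N$ may depend on $H_N$. Detailed balance: $\pi_N(\sigma^1)Q(\sigma^1,\sigma^2)=\pi_N(\sigma^2)Q(\sigma^2,\sigma^1)$. Nearest-neighbor: $Q(x,y)=0$ if $x,y$ differ in more than one coordinate. $\lambda_1=\min_{\mathrm{Var}_{\pi_N}(f)\ne0}\langle (I-Q)f,f\rangle_{L^2(\pi_N)}/\mathrm{Var}_{\pi_N}(f)$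 is the first non-trivial eigenvalue of $I-Q$. **Coercivity.** Let $P$ be a transition matrix on $\Sigma_N$ satisfying detailed balance with respect to the uniform measure. A transition matrix $Q$ of a reversible Markov chain on $\Sigma_N$ is $P$-coercive with constant $A$ ($A>0$) if $A\,P(\sigma^1,\sigma^2)\le Q(\sigma^1,\sigma^2)$ for all $\sigma^1,\sigma^2\in\Sigma_N$. The constant $A_N$ may be random (depend on $H_N$). **Simple random walk.** $P_{SRW}(\sigma^1,\sigma^2)=\frac1N$ if $\sigma^1,\sigma^2$ differ in exactly one coordinate, and $0$ otherwise. *)

(* Defs.v *)
From HB Require Import structures.
From mathcomp Require Import all_boot all_order all_algebra.
From mathcomp Require Import all_classical all_reals all_analysis.

Set Implicit Arguments.
Unset Strict Implicit.
Unset Printing Implicit Defensive.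

Import Order.TTheory GRing.Theory Num.Theory.
Import numFieldNormedType.Exports.

Local Open Scope classical_set_scope.
Local Open Scope ring_scope.

(* {-1, 1}^N, the coordinate +1 being encoded by true. *)
Definition Sigma (N : nat) : finType := {ffun 'I_N -> bool}.

Definition spin {R : realType} {N : nat} (x : Sigma N) (i : 'I_N) : R :=
  if x i then 1 else -1.

Definition overlap {R : realType} {N : nat} (x y : Sigma N) : R :=
  N%:R^-1 * \sum_(i < N) spin x i * spin y i.

Definition hdist {N : nat} (x y : Sigma N) : nat := #|[pred i | x i != y i]|.

Definition unif (R : realType) (N : nat) (x : Sigma N) : R := #|Sigma N|%:R^-1.

(* The beta_p with p >= 1 only; beta 0 is not used. *)
Definition xi {R : realType} (beta : nat -> R) (t : R) : \bar R :=
  (\sum_(1 <= p <oo) (beta p ^+ 2 * t ^+ p)%:E)%E.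

(* Normal law on the line, including the degenerate ones: normal_prob m 0 is
   not the point mass at m but the uniform law on [0, 1], hence the case
   distinction. *)
Definition is_gaussian {d : measure_display} {T : measurableType d}
    {R : realType} (P : probability T R) (X : T -> R) : Prop :=
  exists m s : R, forall V : set R, measurable V ->
    P (X @^-1` V) = if s == 0 then \d_m V else normal_prob m s V.

Definition gaussian_process {d : measure_display} {T : measurableType d}
    {R : realType} (P : probability T R) (I : finType)
    (X : I -> {RV P >-> R}) : Prop :=
  forall a : I -> R, is_gaussian P (fun w => \sum_(i : I) a i * X i w).

Definition mixed_pspin_hamiltonian {d : measure_display} {T : measurableType d}
    {R : realType} (P : probability T R) (beta : nat -> R) (h : R) (N : nat)
    (H : Sigma N -> {RV P >-> R}) : Prop :=
  [/\ gaussian_process H,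
      forall x, ('E_P[H x] = (h * \sum_(i < N) spin x i)%:E)%E
    & forall x y,
        (covariance P (H x) (H y) = N%:R%:E * xi beta (overlap x y))%E].

Section FixedSize.
Variables (R : realType) (N : nat).
Implicit Types (H f mu : Sigma N -> R) (M Q : Sigma N -> Sigma N -> R).

Definition partition_function H : R := \sum_x expR (- H x) * unif R x.

Definition gibbs H (x : Sigma N) : R :=
  expR (- H x) * unif R x / partition_function H.

Definition transition_matrix Q : Prop :=
  (forall x y, 0 <= Q x y) /\ (forall x, \sum_y Q x y = 1).

Definition detailed_balance mu Q : Prop :=
  forall x y, mu x * Q x y = mu y * Q y x.

Definition nearest_neighbor Q : Prop :=
  forall x y, (1 < hdist x y)%N -> Q x y = 0.

Definition wmean mu f : R := \sum_x mu x * f x.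

Definition wvariance mu f : R := wmean mu (fun x => (f x - wmean mu f) ^+ 2).

(* <(I - Q) f, f> in L^2(mu) *)
Definition dirichlet mu Q f : R :=
  \sum_x mu x * ((f x - \sum_y Q x y * f y) * f x).

(* For a transition matrix Q reversible with respect to mu the quotients are
   bounded below by 0, and for N >= 1 the infimum is attained. *)
Definition lambda1 mu Q : R :=
  inf [set dirichlet mu Q f / wvariance mu f | f in [set f | wvariance mu f != 0]].

Definition coercive M Q (A : R) : Prop :=
  0 < A /\ forall x y, A * M x y <= Q x y.

Definition srw (x y : Sigma N) : R := if hdist x y == 1%N then N%:R^-1 else 0.

End FixedSize.

(* Main.v *)
(* The gap of Q is compared crudely with that of the simple random walk.  If e
   bounds the variation of f along every edge of the hypercube, then f varies by
   at most N e globally, so Var f <= N^2 E where E is the sum of the squared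
   increments of f over the edges.  Coercivity gives
   <(I - Q) f, f> >= (A / 2N) (min pi) E, hence lambda_1 >= A (min pi) / (2 N^3).
   Outside an event of probability at most e^{-N}, a Gaussian tail estimate and a
   union bound over the 2^N configurations give |H| <= K N everywhere, so that
   min pi >= 2^{-N} e^{-2KN}.  Each loss is exponential in N at most.

   As lambda_1 is an infimum over uncountably many f, its measurability needs a
   reduction to rational-valued f. *)

Require Import Defs.
From HB Require Import structures.
From mathcomp Require Import all_boot all_order all_algebra.
From mathcomp Require Import all_classical all_reals all_analysis.
From mathcomp Require Import measurable_realfun ring lra.

Set Implicit Arguments.
Unset Strict Implicit.
Unset Printing Implicit Defensive.

Import Order.TTheory GRing.Theory Num.Theory.
Import numFieldNormedType.Exports.

Local Open Scope classical_set_scope.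
Local Open Scope ring_scope.

(** * The spectral gap and the edges of the hypercube *)

(** Unit row sums turn the form into a double sum of [(f x - f y) * f x]. Reversibility allows [x]
    and [y] to be exchanged, and averaging the two versions completes the square. *)
Lemma dirichletE (R : realType) (N : nat) (mu f : Sigma N -> R)
    (Q : Sigma N -> Sigma N -> R) :
    transition_matrix Q -> detailed_balance mu Q ->
  dirichlet mu Q f = 2^-1 * \sum_x \sum_y mu x * Q x y * (f x - f y) ^+ 2.
Proof.
case=> Q0 Q1 db.
have E1 : dirichlet mu Q f = \sum_x \sum_y mu x * Q x y * ((f x - f y) * f x).
  apply: eq_bigr => x _.
  rewrite -[X in mu x * ((X - _) * _)]mul1r -(Q1 x) mulr_suml -sumrB.
  rewrite mulr_suml mulr_sumr; apply: eq_bigr => y _; ring.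
have E2 : dirichlet mu Q f = \sum_x \sum_y mu x * Q x y * ((f y - f x) * f y).
  rewrite E1 exchange_big /=; apply: eq_bigr => y _; apply: eq_bigr => x _.
  by rewrite db.
have -> : \sum_x \sum_y mu x * Q x y * (f x - f y) ^+ 2 =
    dirichlet mu Q f + dirichlet mu Q f.
  rewrite {1}E1 E2 -big_split; apply: eq_bigr => x _ /=.
  rewrite -big_split; apply: eq_bigr => y _ /=; ring.
by field.
Qed.

Lemma dirichlet_ge0 (R : realType) (N : nat) (mu f : Sigma N -> R)
    (Q : Sigma N -> Sigma N -> R) :
    (forall x, 0 <= mu x) -> transition_matrix Q -> detailed_balance mu Q ->
  0 <= dirichlet mu Q f.
Proof.
move=> mu0 tQ db; rewrite dirichletE// mulr_ge0//.
apply: sumr_ge0 => x _; apply: sumr_ge0 => y _.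
by rewrite mulr_ge0 ?sqr_ge0// mulr_ge0 ?tQ.1.
Qed.

Lemma wvariance_ge0 (R : realType) (N : nat) (mu f : Sigma N -> R) :
  (forall x, 0 <= mu x) -> 0 <= wvariance mu f.
Proof. by move=> mu0; apply: sumr_ge0 => x _; rewrite mulr_ge0 ?sqr_ge0. Qed.

(** Induction along a shortest path: [z] copies one differing coordinate of [y] into [x], which
    costs one edge and lowers the distance to [y] by one. *)
Lemma le_hdist (R : realType) (N : nat) (f : Sigma N -> R) (e : R) :
    (forall x y, hdist x y = 1%N -> `|f x - f y| <= e) ->
  forall x y, `|f x - f y| <= (hdist x y)%:R * e.
Proof.
move=> fe x y; move hk : (hdist x y) => k.
elim: k x hk => [|k ih] x hk.
  suff -> : x = y by rewrite subrr normr0 mul0r.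
  apply/ffunP => i; apply/eqP/negPn/negP => xyi.
  by move/card0_eq : hk => /(_ i); rewrite !inE xyi.
have /card_gt0P[i] : (0 < hdist x y)%N by rewrite hk.
rewrite !inE => xyi.
pose z : Sigma N := [ffun j => if j == i then y i else x j].
have xz : hdist x z = 1%N.
  apply/eqP/card1P; exists i => j; rewrite !inE ffunE.
  by case: (eqVneq j i) => [->|]; rewrite ?xyi ?eqxx.
have zy : hdist z y = k.
  move: hk; rewrite /hdist (cardD1 i) !inE xyi add1n => -[<-].
  apply: eq_card => j; rewrite !inE ffunE.
  by case: (eqVneq j i) => [->|]; rewrite ?eqxx.
rewrite -(subrKA (f z)) mulrSr mulrDl mul1r addrC.
rewrite (le_trans (ler_normD _ _))// lerD ?ih// ?fe//.
Qed.

(** As [mu] has mass 1, [f x - wmean mu f] is the [mu]-average over [y] of [f x - f y], hence at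
    most [D] in absolute value. *)
Lemma wvariance_le (R : realType) (N : nat) (mu f : Sigma N -> R) (D : R) :
    (forall x, 0 <= mu x) -> \sum_x mu x = 1 ->
    (forall x y, `|f x - f y| <= D) ->
  wvariance mu f <= D ^+ 2.
Proof.
move=> mu0 mu1 fD.
have D0 : 0 <= D by apply: le_trans (fD [ffun=> true] [ffun=> true]).
rewrite -[leRHS]mul1r -mu1 mulr_suml; apply: ler_sum => x _.
rewrite ler_wpM2l// -real_normK ?num_real// lerXn2r ?nnegrE//.
have -> : f x - wmean mu f = \sum_y mu y * (f x - f y).
  rewrite -[X in X - _]mul1r -mu1 mulr_suml -sumrB.
  by apply: eq_bigr => y _; rewrite mulrBr.
rewrite (le_trans (ler_norm_sum _ _ _))// -[leRHS]mul1r -mu1 mulr_suml.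
by apply: ler_sum => y _; rewrite normrM ger0_norm// ler_wpM2l.
Qed.

(** The sum runs over ordered pairs, so each edge of the hypercube counts twice. *)
Definition edge_energy (R : realType) (N : nat) (f : Sigma N -> R) : R :=
  \sum_x \sum_(y | hdist x y == 1%N) (f x - f y) ^+ 2.

(** A single squared increment is at most the whole energy, so its square root bounds the variation
    along every edge; the hypercube has diameter at most [N]. *)
Lemma wvariance_le_edge_energy (R : realType) (N : nat) (mu f : Sigma N -> R) :
    (forall x, 0 <= mu x) -> \sum_x mu x = 1 ->
  wvariance mu f <= N%:R ^+ 2 * edge_energy f.
Proof.
move=> mu0 mu1.
have E0 : 0 <= edge_energy f.
  by apply: sumr_ge0 => x _; apply: sumr_ge0 => y _; exact: sqr_ge0.
rewrite -[in leRHS](sqr_sqrtr E0) -exprMn; apply: wvariance_le => // x y.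
have fe u v : hdist u v = 1%N -> `|f u - f v| <= Num.sqrt (edge_energy f).
  move=> uv; rewrite -sqrtr_sqr ler_sqrt//.
  rewrite /edge_energy (bigD1 u)//= (bigD1 v)/= ?uv// -addrA lerDl addr_ge0//.
    by apply: sumr_ge0 => z _; exact: sqr_ge0.
  by apply: sumr_ge0 => z _; apply: sumr_ge0 => t _; exact: sqr_ge0.
apply: le_trans (le_hdist fe x y) _.
by rewrite ler_wpM2r ?sqrtr_ge0// ler_nat -[leqRHS](card_ord N) max_card.
Qed.

Lemma edge_energy_le_dirichlet (R : realType) (N : nat) (mu f : Sigma N -> R)
    (Q : Sigma N -> Sigma N -> R) (A p : R) :
    (0 < N)%N -> 0 <= p -> (forall x, p <= mu x) ->
    transition_matrix Q -> detailed_balance mu Q ->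
    coercive (@srw R N) Q A ->
  p * A * edge_energy f <= 2 * N%:R * dirichlet mu Q f.
Proof.
move=> N0 p0 pmu tQ db [A0 AQ].
have N0' : (N%:R : R) != 0 by rewrite pnatr_eq0 -lt0n.
rewrite dirichletE// mulrA (mulrAC 2) divff ?mul1r ?pnatr_eq0//.
rewrite !mulr_sumr; apply: ler_sum => x _.
(* Pairs that are not neighbours contribute nonnegatively and are dropped; on an edge, coercivity
   reads [A <= N * Q x y]. *)
rewrite !mulr_sumr [leRHS](bigID (fun y => hdist x y == 1%N))/=.
rewrite -[leLHS]addr0 lerD//; last first.
  apply: sumr_ge0 => y _; rewrite mulr_ge0// mulr_ge0 ?sqr_ge0// mulr_ge0 ?tQ.1//.
  exact: le_trans (pmu x).
apply: ler_sum => y xy; rewrite mulrA ler_wpM2r ?sqr_ge0//.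
rewrite mulrCA ler_pM// ?(ltW A0)//.
by have := AQ x y; rewrite /srw xy ler_pdivrMr ?ltr0n// mulrC.
Qed.

(** Ensures that the infimum in [lambda1] is over a nonempty set. With positive weights, zero
    variance would force the chosen coordinate to be constant. *)
Lemma nonconstant_wvariance_neq0 (R : realType) (N : nat) (mu : Sigma N -> R) :
    (0 < N)%N -> (forall x, 0 < mu x) ->
  exists f : Sigma N -> R, wvariance mu f != 0.
Proof.
move=> N0 mu0; pose i := Ordinal N0.
exists (fun x : Sigma N => ((x i)%:R : R)); apply/negP => /eqP.
move/psumr_eq0P => v0.
have {}v0 (x : Sigma N) : ((x i)%:R : R) = wmean mu (fun x : Sigma N => (x i)%:R).
  have /eqP := v0 (fun x _ => mulr_ge0 (ltW (mu0 x)) (sqr_ge0 _)) x isT.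
  by rewrite mulf_eq0 gt_eqF//= sqrf_eq0 subr_eq0 => /eqP.
have := etrans (v0 [ffun=> true]) (esym (v0 [ffun=> false])).
by rewrite !ffunE => /eqP; rewrite oner_eq0.
Qed.

Lemma lambda1_ge (R : realType) (N : nat) (mu : Sigma N -> R)
    (Q : Sigma N -> Sigma N -> R) (A p : R) :
    (0 < N)%N -> 0 < p -> (forall x, p <= mu x) -> \sum_x mu x = 1 ->
    transition_matrix Q -> detailed_balance mu Q ->
    coercive (@srw R N) Q A ->
  p * A / (2 * N%:R ^+ 3) <= lambda1 mu Q.
Proof.
move=> N0 p0 pmu mu1 tQ db coA.
have mu0 x : 0 < mu x by exact: lt_le_trans (pmu x).
have mu0' x : 0 <= mu x by exact: ltW.
have N0' : (0 : R) < N%:R by rewrite ltr0n.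
apply: lb_le_inf.
  have [f fv] := nonconstant_wvariance_neq0 N0 mu0.
  by exists (dirichlet mu Q f / wvariance mu f); exists f.
move=> _ [f /= fv <-].
have v0 : 0 < wvariance mu f by rewrite lt_neqAle eq_sym fv wvariance_ge0.
rewrite ler_pdivlMr// mulrAC ler_pdivrMr ?mulr_gt0 ?exprn_gt0//.
have pA0 : 0 <= p * A by rewrite mulr_ge0 ?ltW//; case: coA.
apply: le_trans (ler_wpM2l pA0 (wvariance_le_edge_energy f mu0' mu1)) _.
rewrite mulrCA.
apply: le_trans (ler_wpM2l (sqr_ge0 _)
  (edge_energy_le_dirichlet f N0 (ltW p0) pmu tQ db coA)) _.
by rewrite le_eqVlt; apply/orP; left; apply/eqP; ring.
Qed.

(** * Measurability of the spectral gap *)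

(** Mean, variance and Dirichlet form are polynomials in the finitely many values of [f], so they
    are continuous under pointwise convergence; this permits approximation by rational-valued
    functions. *)
Lemma cvg_wmean (R : realType) (N : nat) (mu : Sigma N -> R)
    (F : nat -> Sigma N -> R) (f : Sigma N -> R) :
  (forall x, F n x @[n --> \oo] --> f x) ->
  wmean mu (F n) @[n --> \oo] --> wmean mu f.
Proof.
move=> Ff; apply: cvg_big => [|x _]; first exact: add_continuous.
by apply: cvgM => //; exact: cvg_cst.
Qed.

Lemma cvg_wvariance (R : realType) (N : nat) (mu : Sigma N -> R)
    (F : nat -> Sigma N -> R) (f : Sigma N -> R) :
  (forall x, F n x @[n --> \oo] --> f x) ->
  wvariance mu (F n) @[n --> \oo] --> wvariance mu f.
Proof.
move=> Ff; apply: cvg_big => [|x _]; first exact: add_continuous.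
apply: cvgM; first exact: cvg_cst.
by under eq_cvg do rewrite expr2; rewrite expr2; apply: cvgM;
  apply: cvgB => //; exact: cvg_wmean.
Qed.

Lemma cvg_dirichlet (R : realType) (N : nat) (mu : Sigma N -> R)
    (Q : Sigma N -> Sigma N -> R) (F : nat -> Sigma N -> R) (f : Sigma N -> R) :
  (forall x, F n x @[n --> \oo] --> f x) ->
  dirichlet mu Q (F n) @[n --> \oo] --> dirichlet mu Q f.
Proof.
move=> Ff; apply: cvg_big => [|x _]; first exact: add_continuous.
apply: cvgM; first exact: cvg_cst.
by apply: cvgM => //; apply: cvgB => //; exact: (@cvg_wmean _ _ (Q x)).
Qed.

Lemma cvg_rat (R : realType) (I : finType) (f : I -> R) :
  exists g : nat -> {ffun I -> rat},
    forall x, (ratr (g n x) : R) @[n --> \oo] --> f x.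
Proof.
have qP (nx : nat * I) : exists q : rat,
    ratr q \in `]f nx.2, f nx.2 + harmonic nx.1[.
  by apply: rat_in_itvoo; rewrite ltrDl harmonic_gt0.
have [q {}qP] := choice qP.
exists (fun n => [ffun x => q (n, x)]) => x.
apply: (@squeeze_cvgr _ _ _ _ (fun=> f x) (fun n => f x + harmonic n)).
- apply: nearW => n; have := qP (n, x).
  by rewrite ffunE in_itv/= => /andP[/ltW -> /ltW].
- exact: cvg_cst.
- rewrite -[X in _ --> X]addr0; apply: cvgD; first exact: cvg_cst.
  exact: cvg_harmonic.
Qed.

(** Clearing the denominator gives a strict inequality continuous in [f], which survives a close
    enough rational approximation and makes sense even at zero variance. *)
Lemma lambda1_ltP (R : realType) (N : nat) (mu : Sigma N -> R)
    (Q : Sigma N -> Sigma N -> R) (t : R) :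
    (0 < N)%N -> (forall x, 0 < mu x) ->
    transition_matrix Q -> detailed_balance mu Q ->
  lambda1 mu Q < t <-> exists g : {ffun Sigma N -> rat},
    dirichlet mu Q (fun x => ratr (g x)) < t * wvariance mu (fun x => ratr (g x)).
Proof.
move=> N0 mu0 tQ db.
have mu0' x : 0 <= mu x by exact: ltW.
split=> [/inf_lt[]|[g]].
- have [f fv] := nonconstant_wvariance_neq0 N0 mu0.
  by exists (dirichlet mu Q f / wvariance mu f); exists f.
- move=> _ [f /= fv <-]; rewrite ltr_pdivrMr; last first.
    by rewrite lt_neqAle eq_sym fv wvariance_ge0.
  rewrite -subr_gt0 => ft.
  have [g gf] := cvg_rat f.
  have : t * wvariance mu (fun x => ratr (g n x)) -
      dirichlet mu Q (fun x => ratr (g n x)) @[n --> \oo] -->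
      t * wvariance mu f - dirichlet mu Q f.
    apply: cvgB; last exact: cvg_dirichlet.
    by apply: cvgM; [exact: cvg_cst|exact: cvg_wvariance].
  move=> /cvgr_gt /(_ _ ft) [n _ /(_ n (leqnn n))] /=; rewrite subr_gt0 => gn.
  by exists (g n).
- set f := (fun x => ratr (g x)) => ft.
  have v0 : 0 < wvariance mu f.
    (* Zero variance would make the Dirichlet form negative, so [f] is admissible in the infimum. *)
    rewrite lt_neqAle wvariance_ge0// andbT eq_sym; apply/eqP => v0.
    by move: ft; rewrite v0 mulr0 ltNge dirichlet_ge0.
  apply: (@le_lt_trans _ _ (dirichlet mu Q f / wvariance mu f)); last first.
    by rewrite ltr_pdivrMr.
  apply: ge_inf; last by exists f => //=; rewrite gt_eqF.
  exists 0 => _ [k _ <-]; rewrite divr_ge0 ?dirichlet_ge0 ?wvariance_ge0//.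
Qed.

(** The rays []-oo, t[] generate the Borel sets, and the preimage of each is a countable union, over
    rational [g], of events defined by finite sums. *)
Lemma measurable_lambda1 (R : realType) (d : measure_display)
    (T : measurableType d) (N : nat) (mu : Sigma N -> T -> R)
    (Q : Sigma N -> Sigma N -> T -> R) :
    (0 < N)%N -> (forall x w, 0 < mu x w) ->
    (forall w, transition_matrix (fun x y => Q x y w)) ->
    (forall w, detailed_balance (mu ^~ w) (fun x y => Q x y w)) ->
    (forall x, measurable_fun setT (mu x)) ->
    (forall x y, measurable_fun setT (Q x y)) ->
  measurable_fun setT (fun w => lambda1 (mu ^~ w) (fun x y => Q x y w)).
Proof.
move=> N0 mu0 tQ db mmu mQ _.
apply: (measurability _ (RGenInftyO.measurableE R)) => // _ [_ [t ->] <-].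
rewrite setTI.
have -> : (fun w => lambda1 (mu ^~ w) (fun x y => Q x y w)) @^-1` `]-oo, t[ =
  \bigcup_(g in @setT {ffun Sigma N -> rat})
    [set w | dirichlet (mu ^~ w) (fun x y => Q x y w) (fun x => ratr (g x)) <
      t * wvariance (mu ^~ w) (fun x => ratr (g x))].
  apply/seteqP; split => w /=; rewrite in_itv/=.
    by move=> /(lambda1_ltP _ N0 (mu0 ^~ w) (tQ w) (db w))[g]; exists g.
  by move=> [g _ /= gw]; apply/(lambda1_ltP _ N0 (mu0 ^~ w) (tQ w) (db w)); exists g.
apply: countable_bigcupT_measurable => [|g]; first exact: countableP.
rewrite -[X in measurable X]setTI.
apply: (measurable_fun_ltr _ _ measurableT (Y := [set true])) => //.
  apply: measurable_sum => x; apply: measurable_funM => //.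
  apply: measurable_funM => //; apply: measurable_funB => //.
  by apply: measurable_sum => y; apply: measurable_funM.
apply: measurable_funM => //.
apply: measurable_sum => x; apply: measurable_funM => //.
apply: measurable_funX; apply: measurable_funB => //.
by apply: measurable_sum => y; apply: measurable_funM.
Qed.

(** * Concentration of Gaussian variables *)

(** Half of the exponent is bounded using [u]; the other half is that of a normal density of doubled
    variance, whose peak is smaller by the factor [Num.sqrt 2]. *)
Lemma normal_pdf_tail (R : realType) (m s u x : R) :
    s != 0 -> 0 <= u -> u <= `|x - m| ->
  normal_pdf m s x <=
    Num.sqrt 2 * expR (- (u ^+ 2 / (4 * s ^+ 2))) *
      normal_pdf m (s * Num.sqrt 2) x.
Proof.
move=> s0 u0 ux.
have s20 : 0 < s ^+ 2 by rewrite exprn_even_gt0.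
have r20 : Num.sqrt 2 != 0 :> R by rewrite gt_eqF// sqrtr_gt0.
rewrite !normal_pdfE ?mulf_neq0//.
have -> : normal_peak (s * Num.sqrt 2) = (Num.sqrt 2)^-1 * normal_peak s.
  rewrite /normal_peak -invfM -sqrtrM//; congr (Num.sqrt _)^-1.
  by rewrite exprMn sqr_sqrtr//; ring.
have -> : normal_fun m s x =
    expR (- (x - m) ^+ 2 / (4 * s ^+ 2)) * normal_fun m (s * Num.sqrt 2) x.
  rewrite /normal_fun -expRD exprMn sqr_sqrtr//; congr expR.
  by field; rewrite s0.
rewrite [leRHS](_ : _ = expR (- (u ^+ 2 / (4 * s ^+ 2))) *
    (normal_peak s * normal_fun m (s * Num.sqrt 2) x)); last by field.
rewrite mulrCA ler_wpM2r ?mulr_ge0 ?normal_peak_ge0 ?normal_fun_ge0//.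
have d0 : 0 <= (4 * s ^+ 2)^-1 by rewrite invr_ge0 mulr_ge0 ?(ltW s20).
rewrite ler_expR mulNr lerN2 ler_wpM2r//.
by rewrite -[leRHS]real_normK ?num_real// lerXn2r ?nnegrE.
Qed.

Lemma measurable_dist_ge (R : realType) (m u : R) :
  measurable [set x : R | u <= `|x - m|].
Proof.
rewrite -[X in measurable X]setTI.
apply: (measurable_fun_ler _ _ measurableT (Y := [set true])) => //.
by apply: measurableT_comp => //; exact: measurable_funB.
Qed.

Lemma normal_prob_tail (R : realType) (m s u : R) : s != 0 -> 0 <= u ->
  (normal_prob m s [set x | (u <= `|x - m|)%R] <=
    (Num.sqrt 2 * expR (- (u ^+ 2 / (4 * s ^+ 2))))%:E)%E.
Proof.
move=> s0 u0; set c := _ * _.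
have c0 : 0 <= c by rewrite mulr_ge0 ?expR_ge0 ?sqrtr_ge0.
have mA := measurable_dist_ge m u; set A := [set x | _] in mA *.
have mpdf a : measurable_fun A (fun x => (normal_pdf m a x)%:E).
  by apply/measurable_EFinP; apply: measurable_funTS; exact: measurable_normal_pdf.
apply: (@le_trans _ _ (\int[lebesgue_measure]_(x in A)
    (c%:E * (normal_pdf m (s * Num.sqrt 2) x)%:E)))%E.
  apply: ge0_le_integral => //.
  - by move=> x _; rewrite lee_fin normal_pdf_ge0.
  - exact: mpdf.
  - exact: (measurable_funeM c%:E (mpdf (s * Num.sqrt 2))).
  - by move=> x Ax; rewrite -EFinM lee_fin normal_pdf_tail.
rewrite ge0_integralZl_EFin//; last 2 first.
- by move=> x _; rewrite lee_fin normal_pdf_ge0.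
- exact: mpdf.
rewrite -[leRHS]mule1 lee_wpmul2l ?lee_fin//.
exact: (@probability_le1 _ _ _ (normal_prob m (s * Num.sqrt 2))).
Qed.

(** The density never exceeds its peak, which is at most [1 / (2 * |s|)] because pi is at least
    2. *)
Lemma normal_prob_itv (R : realType) (m s a b : R) : s != 0 -> a < b ->
  (normal_prob m s `]a, b[%classic <= ((b - a) / (2 * `|s|))%:E)%E.
Proof.
move=> s0 ab.
have s0' : 0 < `|s| by rewrite normr_gt0.
apply: (@le_trans _ _ (\int[lebesgue_measure]_(x in `]a, b[) (normal_peak s)%:E)%E).
  apply: ge0_le_integral => //.
  - by move=> x _; rewrite lee_fin normal_pdf_ge0.
  - by apply/measurable_EFinP; apply: measurable_funTS; exact: measurable_normal_pdf.
  - by move=> x _; rewrite lee_fin normal_pdf_ub.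
rewrite integral_cst//= lebesgue_measure_itv/= lte_fin ab -EFinD -EFinM lee_fin.
rewrite mulrC ler_wpM2l ?subr_ge0 ?(ltW ab)// /normal_peak lef_pV2 ?posrE.
- rewrite -[leLHS]ger0_norm ?mulr_ge0// -sqrtr_sqr ler_wsqrtr//.
  rewrite exprMn real_normK ?num_real// -mulr_natr.
  have := @pi_ge2 R; have := sqr_ge0 s; nra.
- rewrite sqrtr_gt0 pmulrn_lgt0//; apply: mulr_gt0; last exact: pi_gt0.
  by rewrite exprn_even_gt0.
- by rewrite mulr_gt0.
Qed.

Lemma gaussian_tail (R : realType) (d : measure_display) (T : measurableType d)
    (P : probability T R) (X : T -> R) (m s u sigma : R) :
    (forall V, measurable V ->
       P (X @^-1` V) = if s == 0 then \d_m V else normal_prob m s V) ->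
    0 < u -> 0 < sigma -> `|s| <= sigma ->
  (P (X @^-1` [set x | (u <= `|x - m|)%R]) <=
    (Num.sqrt 2 * expR (- (u ^+ 2 / (4 * sigma ^+ 2))))%:E)%E.
Proof.
move=> PX u0 sigma0 ssigma; rewrite PX; last exact: measurable_dist_ge.
have [s0|s0] := eqVneq s 0.
  (* In the degenerate case the point mass sits at [m], outside the tail set since [u > 0]. *)
  rewrite diracE memNset; last by rewrite /= subrr normr0 leNgt u0.
  by rewrite lee_fin mulr_ge0 ?expR_ge0 ?sqrtr_ge0.
have s20 : 0 < s ^+ 2 by rewrite exprn_even_gt0.
apply: le_trans (normal_prob_tail _ s0 (ltW u0)) _.
rewrite lee_fin ler_wpM2l ?sqrtr_ge0// ler_expR lerN2.
have d0 : 0 < 4 * s ^+ 2 by rewrite mulr_gt0.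
have e0 : 0 < 4 * sigma ^+ 2 by rewrite mulr_gt0 ?exprn_gt0.
rewrite ler_wpM2l ?sqr_ge0// lef_pV2 ?posrE//.
by rewrite ler_wpM2l// -[leLHS]real_normK ?num_real// lerXn2r ?nnegrE// ltW.
Qed.

Lemma sqrt2_le (R : realType) : Num.sqrt 2 <= 3 / 2 :> R.
Proof.
rewrite -[leRHS]ger0_norm// -sqrtr_sqr ler_wsqrtr//; lra.
Qed.

(* Chebyshev puts mass 3/4 on a window of radius e around the mean.  The density
   bound then forces s to be at most 2e, and the tail bound forces the window to
   be close to m. *)
Lemma gaussian_concentration (R : realType) (d : measure_display)
    (T : measurableType d) (P : probability T R) (X : {RV P >-> R}) (mean e u : R) :
    is_gaussian P X -> 'E_P[X]%E = mean%:E ->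
    0 < e -> ('V_P[X] <= ((e / 2) ^+ 2)%:E)%E -> 0 < u ->
  (P [set w | (9 * e + u <= `|X w - mean|)%R] <=
    (Num.sqrt 2 * expR (- (u ^+ 2 / (16 * e ^+ 2))))%:E)%E.
Proof.
(* The parameters [m] and [s] of the law are not identified with the moments of [X]; they are only
   controlled up to constants. *)
move=> [m [s PX]] EX e0 VX u0.
pose J : set R := `]mean - e, mean + e[%classic.
have mJ : measurable J by exact: measurable_itv.
have mX (V : set R) : measurable V -> measurable (X @^-1` V).
  by move=> mV; rewrite -[_ @^-1` _]setTI; exact: measurable_funPT.
have JE : X @^-1` J = ~` [set w | e <= `|X w - mean|].
  apply/seteqP; split => w; rewrite /J/=.
    by rewrite in_itv/= => wJ; apply/negP; rewrite -ltNge ltr_norml; lra.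
  by move/negP; rewrite -ltNge ltr_norml in_itv/=; lra.
have PJ : ((3 / 4)%:E <= P (X @^-1` J))%E.
  have e2 : 0 < e ^+ 2 by rewrite exprn_gt0.
  have mE : measurable [set w | e <= `|X w - mean|].
    exact: (mX _ (measurable_dist_ge mean e)).
  have : (P [set w | (e <= `|X w - mean|)%R] <= (1 / 4)%:E)%E.
    have := chebyshev X e0; rewrite EX => /le_trans; apply.
    apply: (@le_trans _ _ ((e ^- 2)%:E * ((e / 2) ^+ 2)%:E)%E).
      by rewrite lee_wpmul2l// lee_fin invr_ge0 ltW.
    rewrite -EFinM lee_fin le_eqVlt; apply/orP; left; apply/eqP.
    by field; rewrite gt_eqF.
  rewrite JE probability_setC//.
  rewrite -(fineK (fin_num_measure P _ mE)).
  by rewrite -EFinB !lee_fin; lra.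
have s2e : `|s| <= 2 * e.
  have [->|s0] := eqVneq s 0; first by rewrite normr0 mulr_ge0// ltW.
  have s0' : 0 < `|s| by rewrite normr_gt0.
  move: PJ; rewrite PX; last exact: measurable_itv.
  rewrite (negbTE s0) => /le_trans /(_ (normal_prob_itv _ s0 _)).
  have ab : mean - e < mean + e by lra.
  move=> /(_ ab); rewrite lee_fin ler_pdivlMr ?mulr_gt0//; lra.
have tail v (v0 : 0 < v) := gaussian_tail PX v0 (mulr_gt0 (ltr0n R 2) e0) s2e.
(* Otherwise all of [J] lies at distance at least [8 * e] from [m]. The tail bound with
   [sigma = 2 * e] then has exponent -4, and [expR 4 >= 5] caps the mass of [J] at 3/10, against
   3/4. *)
have mm : `|m - mean| < 9 * e.
  rewrite ltNge; apply/negP => mm.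
  have e80 : 0 < 8 * e by rewrite mulr_gt0.
  have : (P (X @^-1` J) <= P (X @^-1` [set x | (8 * e <= `|x - m|)%R]))%E.
    apply: le_measure; rewrite ?inE; [exact: (mX _ mJ)| |].
      exact: (mX _ (measurable_dist_ge m _)).
    move=> w; rewrite /J/= in_itv/= => wJ.
    have : `|X w - mean| <= e by rewrite ler_norml; lra.
    by have := ler_distD (X w) m mean; rewrite (distrC m (X w)); lra.
  move=> /(le_trans PJ)/le_trans/(_ (tail _ e80)); rewrite lee_fin.
  have -> : (8 * e) ^+ 2 / (4 * (2 * e) ^+ 2) = 4 by field; rewrite gt_eqF.
  apply/negP; rewrite -ltNge expRN.
  have : (expR 4)^-1 <= 5^-1 :> R.
    by rewrite lef_pV2 ?posrE ?expR_gt0//; have := @expR_ge1Dx R 4; lra.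
  have : 0 < (expR 4)^-1 :> R by rewrite invr_gt0 expR_gt0.
  have := sqrt2_le R; have := sqrtr_ge0 (2 : R); nra.
have -> : 16 * e ^+ 2 = 4 * (2 * e) ^+ 2 by ring.
apply: le_trans (tail _ u0); apply: le_measure; rewrite ?inE.
- exact: (mX _ (measurable_dist_ge mean _)).
- exact: (mX _ (measurable_dist_ge m _)).
- move=> w /=; have := ler_distD m (X w) mean; lra.
Qed.

(** * The Gibbs measure of the mixed p-spin model *)

Lemma unif_sum1 (R : realType) (N : nat) : \sum_x unif R (N := N) x = 1.
Proof.
rewrite sumr_const -[LHS]mulr_natr mulVf// pnatr_eq0 -lt0n.
by apply/card_gt0P; exists [ffun=> true].
Qed.

Lemma unif_gt0 (R : realType) (N : nat) (x : Sigma N) : 0 < unif R x.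
Proof. by rewrite invr_gt0 ltr0n; apply/card_gt0P; exists x. Qed.

Lemma partition_function_gt0 (R : realType) (N : nat) (H : Sigma N -> R) :
  0 < partition_function H.
Proof.
rewrite /partition_function (bigD1 ([ffun=> true] : Sigma N))//=.
rewrite ltr_pwDl ?mulr_gt0 ?expR_gt0 ?unif_gt0// sumr_ge0// => x _.
by rewrite mulr_ge0 ?expR_ge0 ?ltW ?unif_gt0.
Qed.

Lemma gibbs_gt0 (R : realType) (N : nat) (H : Sigma N -> R) (x : Sigma N) :
  0 < gibbs H x.
Proof.
by rewrite divr_gt0 ?partition_function_gt0// mulr_gt0 ?expR_gt0 ?unif_gt0.
Qed.

Lemma gibbs_sum1 (R : realType) (N : nat) (H : Sigma N -> R) :
  \sum_x gibbs H x = 1.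
Proof. by rewrite -mulr_suml divff// gt_eqF// partition_function_gt0. Qed.

(** One factor [expR (- B)] comes from the weight of [x], the other from the partition function, a
    uniform average of terms at most [expR B]. *)
Lemma gibbs_ge (R : realType) (N : nat) (H : Sigma N -> R) (B : R) (x : Sigma N) :
  (forall y, `|H y| <= B) -> expR (- (2 * B)) / #|Sigma N|%:R <= gibbs H x.
Proof.
move=> HB; rewrite /gibbs.
have -> : - (2 * B) = - B + - B by ring.
rewrite expRD (expRN B) mulrAC -/(unif R x).
apply: ler_pM.
- by rewrite mulr_ge0 ?expR_ge0 ?invr_ge0 ?ler0n.
- by rewrite invr_ge0 expR_ge0.
- rewrite ler_wpM2r ?(ltW (unif_gt0 _ _))// -expRN ler_expR lerN2.
  by rewrite (le_trans (ler_norm _)).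
- rewrite lef_pV2 ?posrE ?expR_gt0 ?partition_function_gt0//.
  rewrite -[leRHS]mulr1 -(unif_sum1 R N) mulr_sumr; apply: ler_sum => y _.
  rewrite ler_wpM2r ?(ltW (unif_gt0 _ _))// ler_expR.
  by rewrite (le_trans (ler_norm _))// normrN.
Qed.

Lemma natr_le_expR (R : realType) (n : nat) : n%:R <= expR n%:R :> R.
Proof. by rewrite (le_trans _ (expR_ge1Dx _))// lerDr. Qed.

Lemma two_le_expR1 (R : realType) : 2 <= expR 1 :> R.
Proof. by have := @expR_ge1Dx R 1; rewrite -natr1 addrC. Qed.

Lemma card_Sigma_le (R : realType) (N : nat) : #|Sigma N|%:R <= expR N%:R :> R.
Proof.
rewrite card_ffun card_bool card_ord natrX -[in leRHS](mul1r N%:R) expRM_natr.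
by rewrite lerXn2r ?nnegrE ?expR_ge0 ?two_le_expR1.
Qed.

Lemma lambda1_gibbs_ge (R : realType) (N : nat) (H : Sigma N -> R)
    (Q : Sigma N -> Sigma N -> R) (A K : R) :
    (0 < N)%N -> (forall x, `|H x| <= K * N%:R) ->
    transition_matrix Q -> detailed_balance (gibbs H) Q ->
    coercive (@srw R N) Q A ->
  expR (- ((2 * K + 5) * N%:R)) * A <= lambda1 (gibbs H) Q.
Proof.
move=> N0 HK tQ db coA.
have N0' : (0 : R) < N%:R by rewrite ltr0n.
have N1 : 1 <= N%:R :> R by rewrite ler1n.
have card0 : (0 : R) < #|Sigma N|%:R by rewrite -invr_gt0 (unif_gt0 R [ffun=> true]).
set p := expR (- (2 * (K * N%:R))) / #|Sigma N|%:R.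
have p0 : 0 < p by rewrite divr_gt0 ?expR_gt0.
apply: le_trans (lambda1_ge N0 p0 (fun x => gibbs_ge x HK) (gibbs_sum1 H) tQ db coA).
rewrite mulrAC ler_wpM2r; [|by case: coA => /ltW|] => //.
rewrite /p -mulrA -invfM.
have -> : - ((2 * K + 5) * N%:R) = - (2 * (K * N%:R)) + - (5 * N%:R) by ring.
rewrite expRD ler_wpM2l ?expR_ge0// expRN lef_pV2 ?posrE ?expR_gt0//; last first.
  by rewrite !mulr_gt0 ?exprn_gt0.
(* The 5 is spent as 1 on the cardinality of [Sigma N], 1 on the factor 2, and 3 on [N ^ 3]. *)
have -> : 5 * N%:R = N%:R + (N%:R + N%:R * 3) :> R by ring.
rewrite !expRD expRM_natr.
apply: ler_pM; rewrite ?ler0n ?mulr_ge0 ?exprn_ge0 ?card_Sigma_le ?ler0n//.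
apply: ler_pM; rewrite ?exprn_ge0 ?ler0n//.
  by rewrite (le_trans (two_le_expR1 R))// ler_expR.
by rewrite lerXn2r ?nnegrE ?expR_ge0 ?ler0n// natr_le_expR.
Qed.

Lemma measurable_gibbs (R : realType) (d : measure_display)
    (T : measurableType d) (N : nat) (H : Sigma N -> T -> R) (x : Sigma N) :
    (forall x, measurable_fun setT (H x)) ->
  measurable_fun setT (fun w => gibbs (H ^~ w) x).
Proof.
move=> mH.
have mE y : measurable_fun setT (fun w => expR (- H y w) * unif R y).
  apply: measurable_funM; last exact: measurable_cst.
  by apply: measurableT_comp => //; exact: measurable_funN.
apply: measurable_funM => //.
(* Positivity lets the inverse be written through [expR] and [ln], both measurable. *)
have -> : (fun w => (partition_function (H ^~ w))^-1) =
    (fun w => expR (- ln (partition_function (H ^~ w)))).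
  by apply/funext => w; rewrite expRN lnK// posrE partition_function_gt0.
apply: measurableT_comp => //; apply: measurable_funN.
by apply: measurableT_comp => //; exact: measurable_sum.
Qed.

(** * Uniform bound on the Hamiltonian with exponentially high probability *)

Lemma overlapxx (R : realType) (N : nat) (x : Sigma N) :
  (0 < N)%N -> overlap x x = 1 :> R.
Proof.
move=> N0; rewrite /overlap (eq_bigr (fun=> 1)) => [|i _].
  by rewrite sumr_const card_ord mulVf// pnatr_eq0 -lt0n.
by rewrite /spin; case: ifP => _; rewrite ?mulr1 ?mulrNN ?mulr1.
Qed.

(** The coefficients are nonnegative, so the series at 1 is dominated termwise by the one at
    [1 + eps]. Each [H x] then has finite variance [N * xi 1]. *)
Lemma xi1_fin (R : realType) (beta : nat -> R) (eps : R) :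
    0 < eps -> (xi beta (1 + eps) < +oo)%E ->
  exists2 v : R, 0 <= v & xi beta 1 = v%:E.
Proof.
move=> eps0 xieps.
have xi0 : (0 <= xi beta 1)%E.
  by apply: nneseries_ge0 => p _ _; rewrite lee_fin expr1n mulr1 sqr_ge0.
exists (fine (xi beta 1)); first exact: fine_ge0.
rewrite fineK// ge0_fin_numE//; apply: le_lt_trans xieps.
apply: lee_nneseries => p _ /=.
  by move=> _; rewrite lee_fin expr1n mulr1 sqr_ge0.
by rewrite lee_fin ler_wpM2l ?sqr_ge0// expr1n exprn_ege1// lerDl ltW.
Qed.

Lemma pspin_is_gaussian (R : realType) (d : measure_display)
    (T : measurableType d) (P : probability T R) (I : finType)
    (X : I -> {RV P >-> R}) (x : I) :
  gaussian_process X -> is_gaussian P (X x).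
Proof.
move=> /(_ (fun i => (i == x)%:R)).
suff -> : (fun w => \sum_i (i == x)%:R * X i w) = X x by [].
apply/funext => w; rewrite (bigD1 x)//= eqxx mul1r big1 ?addr0// => i /negbTE ->.
by rewrite mul0r.
Qed.

Lemma norm_mean_le (R : realType) (N : nat) (h : R) (x : Sigma N) :
  0 <= h -> `|h * \sum_(i < N) spin x i| <= h * N%:R.
Proof.
move=> h0; rewrite normrM ger0_norm// ler_wpM2l// (le_trans (ler_norm_sum _ _ _))//.
rewrite -[in leRHS](card_ord N) -sum1_card natr_sum; apply: ler_sum => i _.
by rewrite /spin; case: ifP => _; rewrite ?normrN normr1.
Qed.

Lemma measure_bigsetU_le (d : measure_display) (T : measurableType d)
    (R : realType) (mu : {measure set T -> \bar R}) (I : Type) (s : seq I)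
    (F : I -> set T) : (forall i, measurable (F i)) ->
  (mu (\big[setU/set0]_(i <- s) F i) <= \sum_(i <- s) mu (F i))%E.
Proof.
move=> mF; elim: s => [|i s ih]; first by rewrite !big_nil measure0.
rewrite !big_cons; apply: le_trans (measureU2 _ _ _) _ => //.
  exact: bigsetU_measurable.
exact: leeD.
Qed.

Lemma pspin_max_tail (R : realType) (d : measure_display)
    (T : measurableType d) (P : probability T R) (beta : nat -> R) (h v : R)
    (N : nat) (H : Sigma N -> {RV P >-> R}) :
    (0 < N)%N -> 0 <= h -> 0 <= v -> xi beta 1 = v%:E ->
    mixed_pspin_hamiltonian beta h H ->
  exists2 U : set T, measurable U /\ (P U <= (expR (- N%:R))%:E)%E &
    forall w, ~ U w -> forall x, `|H x w| <=
      (h + 18 * Num.sqrt (v + 1) + Num.sqrt (192 * (v + 1))) * N%:R.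
Proof.
move=> N0 h0 v0 xiv [Hgauss HE HV].
have N0' : (0 : R) < N%:R by rewrite ltr0n.
have N1 : 1 <= N%:R :> R by rewrite ler1n.
have k0 : 0 < v + 1 by rewrite ltr_wpDl.
(* Using [v + 1] in place of [v] keeps the scales positive when [v = 0]. The choice of [e] gives
   [(e / 2) ^ 2 = k * N], a bound on the variance, and that of [u] gives
   [u ^ 2 / (16 * e ^ 2) = 3 * N]. *)
set k := v + 1 in k0 *.
pose e := 2 * Num.sqrt (k * N%:R).
pose u := Num.sqrt (192 * k) * N%:R.
have e0 : 0 < e by rewrite mulr_gt0// sqrtr_gt0 mulr_gt0.
have u0 : 0 < u by rewrite mulr_gt0// sqrtr_gt0 mulr_gt0.
have e2 : e ^+ 2 = 4 * (k * N%:R).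
  by rewrite exprMn sqr_sqrtr ?mulr_ge0 ?(ltW k0)//; ring.
have u2 : u ^+ 2 = 192 * k * N%:R ^+ 2.
  by rewrite exprMn sqr_sqrtr ?mulr_ge0 ?(ltW k0).
pose mean x := h * \sum_(i < N) spin x i : R.
pose F x := [set w | 9 * e + u <= `|H x w - mean x|].
have mF x : measurable (F x).
  rewrite -[F x]setTI.
  exact: (measurable_funPT (H x) measurableT _ (measurable_dist_ge (mean x) _)).
have PF x : (P (F x) <= (Num.sqrt 2 * expR (- (3 * N%:R)))%:E)%E.
  have -> : 3 * N%:R = u ^+ 2 / (16 * e ^+ 2).
    by rewrite u2 e2; field; rewrite !gt_eqF.
  apply: gaussian_concentration => //; first exact: pspin_is_gaussian.
  rewrite /variance HV overlapxx// xiv -EFinM lee_fin exprMn e2.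
  by rewrite [leRHS](_ : _ = N%:R * k); [rewrite ler_wpM2l// lerDl|field].
exists (\big[setU/set0]_(x : Sigma N) F x); first split.
- exact: bigsetU_measurable.
- apply: le_trans (measure_bigsetU_le _ _ mF) _.
  apply: le_trans (lee_sum _ (fun x _ => PF x)) _.
  rewrite sumEFin lee_fin sumr_const -[leLHS]mulr_natl.
  (* Of the decay [3 * N], one [N] pays for the number of configurations and one for
     [Num.sqrt 2]. *)
  have -> : - N%:R = N%:R + (N%:R + - (3 * N%:R)) :> R by ring.
  rewrite !expRD; apply: ler_pM; rewrite ?ler0n ?card_Sigma_le//.
  rewrite ler_wpM2r ?expR_ge0// (le_trans (sqrt2_le R))//.
  have := two_le_expR1 R; have : expR 1 <= expR N%:R :> R by rewrite ler_expR.
  by lra.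
- move=> w Uw x.
  have Fxw : `|H x w - mean x| <= 9 * e + u.
    rewrite leNgt; apply/negP => /ltW Fxw; apply: Uw.
    by rewrite (bigD1 x)//=; left.
  (* The fluctuation scale is of order the square root of [N]; it is relaxed to order [N]. *)
  have eN : e <= 2 * (Num.sqrt k * N%:R).
    rewrite ler_wpM2l// sqrtrM ?(ltW k0)// ler_wpM2l ?sqrtr_ge0//.
    rewrite -[leRHS]ger0_norm// -sqrtr_sqr ler_wsqrtr//.
    by rewrite expr2 ler_peMl.
  have := norm_mean_le x h0; rewrite -/(mean x) => mh.
  have : `|H x w| <= `|H x w - mean x| + `|mean x|.
    by rewrite -{1}(subrK (mean x) (H x w)) ler_normD.
  move: Fxw; rewrite /u; lra.
Qed.

(** The limit superior is an infimum over eventual sets, and the positive integers form one; this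
    discards [N = 0]. *)
Lemma limn_esup_le (R : realType) (f : nat -> \bar R) (l : \bar R) :
  (forall n, (0 < n)%N -> (f n <= l)%E) -> (limn_esup f <= l)%E.
Proof.
move=> fl; apply: (@le_trans _ _ (ereal_sup [set f n | n in [set n | (0 < n)%N]])).
  apply: ereal_inf_lbound; exists [set n | (0 < n)%N] => //.
  by exists 1%N.
by apply: ge_ereal_sup => _ [n n0 <-]; exact: fl.
Qed.

Theorem theorem1p11 (R : realType) (d : measure_display) (T : measurableType d)
  (P : probability T R) (beta : nat -> R) (h : R)
  (xi_finite : exists2 eps : R, 0 < eps & (xi beta (1 + eps)%R < +oo)%E)
  (h_ge0 : 0 <= h)
  (H : forall N : nat, Sigma N -> {RV P >-> R})
  (H_pspin : forall N : nat, (0 < N)%N -> mixed_pspin_hamiltonian beta h (H N))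
  (Q : forall N : nat, Sigma N -> Sigma N -> {RV P >-> R})
  (Q_reversible : forall (N : nat) (w : T), (0 < N)%N ->
     [/\ transition_matrix (fun x y => Q N x y w),
         nearest_neighbor (fun x y => Q N x y w)
       & detailed_balance (gibbs (fun x => H N x w)) (fun x y => Q N x y w)])
  (A : nat -> {RV P >-> R})
  (Q_coercive : {ae P, forall w : T, forall N : nat, (0 < N)%N ->
     coercive (@srw R N) (fun x y => Q N x y w) (A N w)}) :
  exists2 c' : R, 0 < c' &
    (limn_esup (fun N : nat => N%:R^-1%:E *
       lne (P [set w | (N%:R^-1 * ln (lambda1 (gibbs (fun x => H N x w))
                                              (fun x y => Q N x y w))
                        < - c' + N%:R^-1 * ln (A N w))%R])) < 0)%E.
Proof.
have [eps eps0 xieps] := xi_finite.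
have [v v0 xiv] := xi1_fin eps0 xieps.
pose K := h + 18 * Num.sqrt (v + 1) + Num.sqrt (192 * (v + 1)).
have K0 : 0 <= K by rewrite !addr_ge0 ?mulr_ge0 ?sqrtr_ge0.
(* [B] is a null set outside which coercivity holds for all [N >= 1] at once. *)
have [B [mB PB0 coB]] := Q_coercive.
exists (2 * K + 5); first by rewrite ltr_wpDl ?mulr_ge0.
apply: (@le_lt_trans _ _ (-1)%E); last by rewrite lte_fin ltrN10.
apply: limn_esup_le => N N0.
have N0' : (0 : R) < N%:R by rewrite ltr0n.
set E := [set w | _].
have mE : measurable E.
  rewrite -[E]setTI.
  apply: (measurable_fun_ltr _ _ measurableT (Y := [set true])) => //.
    apply: measurable_funM => //; apply: measurableT_comp => //.
    apply: (measurable_lambda1 (mu := fun x w => gibbs (fun y => H N y w) x)) => //.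
    - by move=> x w; exact: gibbs_gt0.
    - by move=> w; case: (Q_reversible N w N0).
    - by move=> w; case: (Q_reversible N w N0).
    - by move=> x; apply: (measurable_gibbs (H := fun y w => H N y w)).
  apply: measurable_funD => //; apply: measurable_funM => //.
  by apply: measurableT_comp.
have [U [mU PU] HU] := pspin_max_tail N0 h_ge0 v0 xiv (H_pspin N N0).
have EUB : E `<=` U `|` B.
  move=> w Ew; apply: contrapT => /not_orP[Uw Bw].
  have coA : coercive (@srw R N) (fun x y => Q N x y w) (A N w).
    by apply: contrapT => nco; apply: Bw; apply: coB => /(_ N N0).
  have [tQ _ db] := Q_reversible N w N0.
  have lam := lambda1_gibbs_ge N0 (HU w Uw) tQ db coA.
  have [A0 _] := coA.
  (* Positivity of the gap is what allows logarithms to be compared. *)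
  have lam0 := lt_le_trans (mulr_gt0 (expR_gt0 _) A0) lam.
  move: Ew; rewrite /E/=; apply/negP; rewrite -leNgt.
  move: lam; rewrite -ler_ln ?posrE ?mulr_gt0 ?expR_gt0//.
  rewrite lnM ?posrE ?expR_gt0// expRK => lam.
  rewrite -(ler_pM2l N0') mulrDr !mulrA divff ?gt_eqF// !mul1r.
  by apply: le_trans lam; rewrite mulrN mulrC.
have PE : (P E <= (expR (- N%:R))%:E)%E.
  apply: (@le_trans _ _ (P (U `|` B))).
    by apply: le_measure => //; rewrite inE//; exact: measurableU.
  apply: le_trans (measureU2 _ mU mB) _.
  have PB : (P B <= 0)%E by rewrite PB0.
  by rewrite -[leRHS]adde0; exact: leeD.
(* The extended logarithm is monotone on nonnegative values, so [P E = 0] needs no separate case. *)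
have lnE : (lne (P E) <= (- N%:R)%:E)%E.
  rewrite -[leRHS](_ : lne (expR (- N%:R))%:E = _); last first.
    by rewrite lne_EFin ?expR_gt0// expRK.
  by rewrite lee_lne// in_itv/= ?lee_fin ?expR_ge0 ?measure_ge0 leey.
apply: le_trans (lee_wpmul2l _ lnE) _; first by rewrite lee_fin invr_ge0 ltW.
by rewrite -EFinM mulrN mulVf ?gt_eqF.
Qed.
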